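(* Let $p$ be a prime and $(t_n)_{n\ge1}$ a sequence of positive integers with $t_n\le n$ for each $n$ and $\lim_{n\to\infty}(t_n-\log_p n)=\infty$. Then there exists a sequence $(G_n)_{n\ge1}$ of bipartite graphs such that $G_n$ has a bipartition $\{A_n,B_n\}$ with $A_n,B_n$ disjoint sets of size $n$, $1\le|N_{G_n}(a)|,|N_{G_n}(b)|\le\min\{t_n,\log_p n+\log\log n\}$ for all $a\in A_n$, $b\in B_n$, and $\lim_{n\to\infty}c(G_n)=0$.
   Context: $\log$ denotes the natural logarithm. For a (multi)graph $G$ and $S\subseteq V(G)$, $N_G(S)$ is the set of vertices not in $S$ adjacent to some vertex of $S$, and $N_G(v)=N_G(\{v\})$. For a bipartite (multi)graph $G$ with bipartition $\{A,B\}$, $|A|=|B|=n$, define $\mathcal{F}_A(G)=\{S: \varnothing\ne S\subsetneq A,\ N_G(S)\ne B,\ N_G(w)\not\subseteq N_G(S)\text{ for all }w\in A\setminus S\}$ and $c(G)=\sum_{S\in\mathcal{F}_A(G)}p^{|S|-|N_G(S)|}$.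
   Formalization: The bound log_p n + log log n on the degrees is required only for those n where it is at least 1 (it is undefined at n = 1 and below 1 at p = n = 2, where no graph can qualify); the bounds 1 and t_n are required for every n ≥ 1. *)

(* Defs.v *)
From HB Require Import structures.
From mathcomp Require Import all_boot all_order all_algebra.
From mathcomp Require Import all_classical all_reals all_analysis.

Set Implicit Arguments.
Unset Strict Implicit.
Unset Printing Implicit Defensive.

Import Order.TTheory GRing.Theory Num.Theory.

Record sgraph := SGraph {
  vertex :> finType;
  adj : rel vertex;
  adj_sym : symmetric adj;
  adj_irrefl : irreflexive adj
}.

Definition nbhd (G : sgraph) (S : {set G}) : {set G} :=
  [set v | (v \notin S) && [exists u in S, adj u v]].

Definition bipartition (G : sgraph) (A B : {set G}) : Prop :=
  [/\ [disjoint A & B],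
      A :|: B = [set: G] &
      forall u v : G, adj u v ->
        (u \in A) && (v \in B) || (u \in B) && (v \in A)].

Definition closedFamily (G : sgraph) (A B : {set G}) : {set {set G}} :=
  [set S : {set G} |
    [&& S != finset.set0, S \proper A, nbhd S != B &
        [forall w in A :\: S, ~~ (nbhd [set w] \subset nbhd S)]]].

(* The exponent #|S| - #|nbhd S| is an integer and may be negative. *)
Definition cG (R : realType) (p : nat) (G : sgraph) (A B : {set G}) : R :=
  (\sum_(S in closedFamily A B) (p%:R : R) ^ (#|S|%:Z - #|nbhd S|%:Z))%R.

Definition logb (R : realType) (p : nat) (x : R) : R := (ln x / ln p%:R)%R.

(* log_p n + log log n; only meaningful for n >= 2. *)
Definition degBound (R : realType) (p n : nat) : R :=
  (logb p n%:R + ln (ln n%:R))%R.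

(* Main.v *)
(* [G_n] joins two copies of ['I_n] by the union of [d] independent uniformly random
   permutations, [d] being the largest admissible degree. A closed set [S] and the set [T] of
   vertices outside [N(S)] determine each other and contribute [p ^ (|S| + |T| - n)], so it
   suffices to sum over the smaller one of the two; the random graph and its mirror image
   have the same law, hence it suffices to bound the expectation of
   [p ^ (|S| - |N(S)|)] over the nonempty [S] with [|S| <= n - |N(S)|].
   - For [|S| = s <= n / (16 p d)] this expectation is at most [p ^ (s - s d)] up to a small
     factor, and summing over the ['C(n, s)] sets gives a geometric series of ratio
     [O(n / p ^ d)].
   - For larger [s] up to a small multiple of [n], monotonicity in [s] gives a bound
     exponentially small in [n] that beats the number of such sets.
   - For still larger [s], two sets of size [s] span no edge with probability at most
     [(1 - s / n) ^ (s d)], which beats the [4 ^ n] pairs of sets because [d] is large. *)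
Require Import Defs.
From HB Require Import structures.
From mathcomp Require Import all_boot all_order all_algebra fingroup perm.
From mathcomp Require Import all_classical all_reals all_analysis.
From mathcomp Require Import fintype finset ring lra zify.

Set Implicit Arguments.
Unset Strict Implicit.
Unset Printing Implicit Defensive.

Import Order.TTheory GRing.Theory Num.Theory.
Import numFieldNormedType.Exports.
Local Open Scope ring_scope.

(** * Counting permutations that move one set off another *)

Definition avoiding (V : finType) (S T : {set V}) : {set {perm V}} :=
  [set s : {perm V} | [forall x in S, s x \notin T]].

Lemma avoidingP (V : finType) (S T : {set V}) (s : {perm V}) :
  reflect (forall x, x \in S -> s x \notin T) (s \in avoiding S T).
Proof. by rewrite inE; exact: forall_inP. Qed.

Lemma avoidingU1 (V : finType) (S T : {set V}) x (s : {perm V}) :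
  (s \in avoiding (x |: S) T) = (s x \notin T) && (s \in avoiding S T).
Proof.
apply/avoidingP/andP => [h|[hx /avoidingP h] y].
  split; first by apply: h; rewrite setU11.
  by apply/avoidingP => y yS; apply: h; rewrite setU1r.
by rewrite !inE => /orP[/eqP->|/h].
Qed.

(* Multiplying by a transposition of two points outside [S] shows that the count does not
   depend on the added point, so it equals its average over all points outside [S]. *)
Lemma card_avoidingU1 (V : finType) (S T : {set V}) x : x \notin S ->
  (#|avoiding (x |: S) T| * (#|V| - #|S|) = #|avoiding S T| * (#|V| - #|S| - #|T|))%N.
Proof.
move=> xS.
have sym y : y \notin S -> #|avoiding (y |: S) T| = #|avoiding (x |: S) T|.
  move=> yS; rewrite -(card_imset (avoiding (y |: S) T) (mulgI (tperm x y))).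
  apply: eq_card => s; apply/imsetP/idP => [[s' + ->]|].
    rewrite !avoidingU1 permM tpermL => /andP[-> /avoidingP h] /=.
    apply/avoidingP => z zS; rewrite permM tpermD ?h //.
      by apply: contraNneq xS => ->.
    by apply: contraNneq yS => ->.
  move=> hs; exists (tperm x y * s)%g; last by rewrite mulgA tperm2 mul1g.
  move: hs; rewrite !avoidingU1 permM tpermR => /andP[-> /avoidingP h] /=.
  apply/avoidingP => z zS; rewrite permM tpermD ?h //.
    by apply: contraNneq xS => ->.
  by apply: contraNneq yS => ->.
have cV : (#|V| - #|S| = #|~: S|)%N by rewrite [RHS]cardsCs setCK.
have -> : (#|avoiding (x |: S) T| * (#|V| - #|S|) =
    \sum_(y in ~: S) #|avoiding (y |: S) T|)%N.
  rewrite cV mulnC -sum_nat_const; apply: eq_bigr => y.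
  by rewrite inE => /sym.
have -> : (\sum_(y in ~: S) #|avoiding (y |: S) T| =
    \sum_(y in ~: S) \sum_(s in avoiding S T) (s y \notin T))%N.
  apply: eq_bigr => y _; rewrite -sum1_card big_mkcond /= [RHS]big_mkcond /=.
  by apply: eq_bigr => s _; rewrite avoidingU1; case: (_ \notin _); case: (_ \in _).
rewrite exchange_big /= -sum_nat_const; apply: eq_bigr => s /avoidingP hs.
rewrite -big_mkcondr /= sum1_card cV.
rewrite -(card_preimset T (@perm_inj _ s)).
have sub : s @^-1: T \subset ~: S.
  by apply/subsetP => z; rewrite !inE => zT; apply/negP => /hs; rewrite zT.
rewrite -(setIidPr sub) -cardsD; apply: eq_card => z.
by rewrite !inE unfold_in /= !inE andbC.
Qed.

(** Images are drawn without replacement: once the images of [S] avoid [T], the next one does so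
    with chance [(n - #|S| - #|T|) / (n - #|S|)], where [n] is [#|V|], and this is at most the
    chance [(n - #|T|) / n] of a draw with replacement. *)
Lemma card_avoiding_le (V : finType) (S T : {set V}) :
  (#|avoiding S T| * #|V| ^ #|S| <= (#|V|)`! * (#|V| - #|T|) ^ #|S|)%N.
Proof.
have [m] := ubnP #|S|; elim: m S => // m IHm S; rewrite ltnS => Sm.
have [->|[x xS']] := set_0Vmem S.
  rewrite cards0 !expn0 !muln1 -cardsT -card_perm; apply: subset_leq_card.
  by apply/subsetP => s _; rewrite unfold_in; apply/subsetP => x _; rewrite inE.
move: Sm; rewrite -(setD1K xS'); move: (S :\ x) (setD11 x S) => {xS'}S xS Sm.
have {}xS : x \notin S by rewrite xS.
rewrite cardsU1 xS add1n in Sm; have {IHm}IH := IHm _ Sm.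
rewrite cardsU1 xS add1n !expnS.
set a := #|avoiding (x |: S) T|; set b := #|avoiding S T| in IH *.
have h := card_avoidingU1 T xS; rewrite -/a -/b in h.
have Sn : (#|S| < #|V|)%N.
  by rewrite -cardsT; apply: proper_card; apply/properP; split; [apply/subsetP|exists x].
have [tV sV] := (max_card (mem T), max_card (mem S)).
have ab : (a * #|V| <= b * (#|V| - #|T|))%N.
  rewrite -(@leq_pmul2r (#|V| - #|S|)) ?subn_gt0//.
  rewrite mulnAC h -!mulnA leq_mul2l; apply/orP; right.
  move: #|V| #|S| #|T| Sn tV sV => k l j; nia.
rewrite mulnA; apply: leq_trans (leq_mul ab (leqnn _)) _.
by rewrite mulnAC mulnCA [X in (X <= _)%N]mulnC leq_mul.
Qed.

(** * Neighbourhoods under a tuple of permutations *)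

Definition nbr d (V : finType) (w : {ffun 'I_d -> {perm V}}) (S : {set V}) : {set V} :=
  \bigcup_i [set w i x | x in S].

Lemma nbrP d (V : finType) (w : {ffun 'I_d -> {perm V}}) (S : {set V}) y :
  reflect (exists i, exists2 x, x \in S & y = w i x) (y \in nbr w S).
Proof.
apply: (iffP bigcupP) => [[i _ /imsetP[x xS ->]]|[i [x xS ->]]]; first by exists i, x.
by exists i => //; apply: imset_f.
Qed.

(** Splits the event into one condition per permutation, so that counting it gives a [d]-th power;
    this is where independence enters. *)
Lemma disjoint_nbr d (V : finType) (w : {ffun 'I_d -> {perm V}}) (S T : {set V}) :
  [disjoint nbr w S & T] = (w \in ffun_on (mem (avoiding S T))).
Proof.
apply/pred0P/ffun_onP => [h i|h y].
  apply/avoidingP => x xS; apply/negP => wT.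
  have := h (w i x); rewrite /= wT andbT => /negP; apply.
  by apply/nbrP; exists i, x.
apply/negP => /andP[/nbrP[i [x xS ->]] wT].
by have /avoidingP/(_ x xS)/negP := h i.
Qed.

Lemma leq_card_nbr d (V : finType) (w : {ffun 'I_d -> {perm V}}) (S : {set V}) :
  (0 < d)%N -> (#|S| <= #|nbr w S|)%N.
Proof.
move=> d0; rewrite -(card_imset (mem S) (@perm_inj _ (w (Ordinal d0)))).
apply: subset_leq_card; apply/subsetP => y /imsetP[x xS ->].
by apply/nbrP; exists (Ordinal d0), x.
Qed.

(** * Expectations over a finite uniform sample space *)

Definition avg (R : realType) (W : finType) (f : W -> R) : R :=
  (\sum_w f w) / #|W|%:R.

Lemma ler_avg (R : realType) (W : finType) (f g : W -> R) :
  (forall w, f w <= g w) -> avg f <= avg g.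
Proof. by move=> fg; rewrite ler_wpM2r ?invr_ge0 ?ler0n ?ler_sum. Qed.

Lemma avg_sum (R : realType) (W I : finType) (P : pred I) (f : I -> W -> R) :
  avg (fun w => \sum_(i | P i) f i w) = \sum_(i | P i) avg (f i).
Proof. by rewrite /avg exchange_big /= mulr_suml. Qed.

Lemma avgZ (R : realType) (W : finType) (a : R) (f : W -> R) :
  avg (fun w => a * f w) = a * avg f.
Proof. by rewrite /avg -mulr_sumr mulrA. Qed.

Lemma exists_le_avg (R : realType) (W : finType) (f : W -> R) :
  (0 < #|W|)%N -> exists w, f w <= avg f.
Proof.
move=> W0; apply/existsP; rewrite -[X in is_true X]negbK negb_exists; apply/negP => /forallP h.
have : avg f * #|W|%:R < \sum_w f w.
  rewrite mulr_natr -sumr_const; apply: ltr_sum => [|w _].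
    by have /card_gt0P[w _] := W0; apply/hasP; exists w => //; rewrite mem_index_enum.
  by rewrite ltNge h.
by rewrite /avg divfK ?ltxx // pnatr_eq0 -lt0n.
Qed.

Lemma card_perms (d : nat) (V : finType) :
  #|{ffun 'I_d -> {perm V}}| = ((#|V|)`! ^ d)%N.
Proof.
rewrite card_ffun card_ord; congr (_ ^ _)%N.
rewrite -cardsT -[#|V|]cardsT -card_perm; apply: eq_card => s.
by rewrite inE unfold_in; apply/esym/subsetP => x _; rewrite inE.
Qed.

Lemma avg_disjoint_nbr (R : realType) d (V : finType) (S T : {set V}) : (0 < #|V|)%N ->
  avg (fun w : {ffun 'I_d -> {perm V}} => [disjoint nbr w S & T]%:R)
    <= (1 - #|T|%:R / #|V|%:R) ^+ (#|S| * d) :> R.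
Proof.
move=> V0; rewrite /avg card_perms.
have -> : \sum_(w : {ffun 'I_d -> {perm V}}) [disjoint nbr w S & T]%:R
    = ((#|avoiding S T| ^ d)%N)%:R :> R.
  have <- : #|(ffun_on (mem (avoiding S T)) : {pred {ffun 'I_d -> {perm V}}})| =
      (#|avoiding S T| ^ d)%N by rewrite card_ffun_on card_ord.
  rewrite -sum1_card natr_sum [RHS]big_mkcond /=.
  by apply: eq_bigr => w _; rewrite disjoint_nbr; case: (_ \in _).
have n0 : (#|V|%:R : R) != 0 by rewrite pnatr_eq0 -lt0n.
rewrite exprM !natrX -expr_div_n lerXn2r// ?nnegrE ?divr_ge0 ?ler0n//.
  rewrite exprn_ge0// subr_ge0 ler_pdivrMr ?ltr0n// mul1r ler_nat max_card//.
rewrite ler_pdivrMr ?ltr0n ?fact_gt0//.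
have -> : 1 - #|T|%:R / #|V|%:R = (#|V| - #|T|)%:R / #|V|%:R :> R.
  by rewrite natrB ?max_card// mulrBl divff.
rewrite expr_div_n mulrAC ler_pdivlMr ?exprn_gt0 ?ltr0n// -!natrX -!natrM ler_nat.
by rewrite [X in (_ <= X)%N]mulnC card_avoiding_le.
Qed.

(** * Generating sums over subsets and moments of the neighbourhood size *)

Lemma sum_sets_exp (R : realType) (V : finType) (a b : R) :
  \sum_(T : {set V}) a ^+ #|T| * b ^+ #|~: T| = (a + b) ^+ #|V|.
Proof.
rewrite -prodr_const (bigA_distr _ _ (fun=> a) (fun=> b)) /=; apply: eq_bigr => T _.
rewrite (bigID (mem T)) /=; congr (_ * _).
  by rewrite (eq_bigr (fun=> a)) ?prodr_const // => i ->.
rewrite (eq_bigr (fun=> b)) => [|i /negbTE->//].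
by rewrite prodr_const; congr (_ ^+ _); apply: eq_card => i; rewrite !inE.
Qed.

Lemma sum_subsets_exp (R : realType) (V : finType) (U : {set V}) (a : R) :
  \sum_(T : {set V} | T \subset U) a ^+ #|T| = (a + 1) ^+ #|U|.
Proof.
(* Outside [U] the factor is [0 + 1], so every subset that leaves [U] contributes zero. *)
have -> : (a + 1) ^+ #|U| = \prod_i ((if i \in U then a else 0) + 1).
  rewrite -prodr_const big_mkcond; apply: eq_bigr => i _.
  by case: (i \in U); rewrite ?add0r.
rewrite (bigA_distr _ _ (fun i => if i \in U then a else 0) (fun=> 1)) /= big_mkcond.
apply: eq_bigr => T _; rewrite -big_mkcond /=; case: ifPn => [/subsetP TU|/subsetPn[x xT xU]].
  by rewrite (eq_bigr (fun=> a)) ?prodr_const// => i /TU ->.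
by rewrite (bigD1 x)//= (negbTE xU) mul0r.
Qed.

(** Since [expR (- x) >= 1 - x], it suffices that [(1 - x) * (1 + x + 2 * x ^+ 2) = 1 + x ^+ 2 * (1
    - 2 * x)] is at least 1. *)
Lemma expR_le_quadratic (R : realType) (x : R) :
  0 <= x -> 2 * x <= 1 -> expR x <= 1 + x + 2 * x ^+ 2.
Proof.
move=> x0 x1; have h := expR_ge1Dx (- x).
rewrite -[x in expR x]opprK expRN -div1r ler_pdivrMr ?expR_gt0//.
apply: le_trans (ler_wpM2l _ h); first by nra.
by nra.
Qed.

(* Expanding [q ^ (#|V| - #|nbr w S|)] as a sum over the subsets [T] disjoint from
   [nbr w S] turns the average into the [m]-th moment of a binomial variable [Z / #|V|]
   of mean [1 / q], which [z <= expR (q * z - 1) / q] reduces to an exponential moment. *)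
Lemma avg_inv_nbr (R : realType) d (V : finType) (S : {set V}) (q : R) m :
  (0 < #|V|)%N -> 1 <= q -> (m <= #|S| * d)%N -> 2 * q * m%:R <= #|V|%:R ->
  avg (fun w : {ffun 'I_d -> {perm V}} => (q ^+ #|nbr w S|)^-1)
    <= (q ^+ m)^-1 * expR (2 * q * m%:R ^+ 2 / #|V|%:R).
Proof.
move=> V0 q1 msd qm; have q0 : 0 < q by lra.
have [nz qz] : #|V|%:R != 0 :> R /\ q != 0 by rewrite pnatr_eq0 -lt0n V0 gt_eqF.
have n0 : 0 < #|V|%:R :> R by rewrite ltr0n.
have expand (w : {ffun 'I_d -> {perm V}}) : (q ^+ #|nbr w S|)^-1 =
    (q ^+ #|V|)^-1 * \sum_(T : {set V}) (q - 1) ^+ #|T| * [disjoint nbr w S & T]%:R.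
  have -> : \sum_(T : {set V}) (q - 1) ^+ #|T| * [disjoint nbr w S & T]%:R =
      q ^+ #|~: nbr w S|.
    rewrite -[q in RHS](subrK 1) -sum_subsets_exp [RHS]big_mkcond /=.
    apply: eq_bigr => T _; rewrite disjoint_sym disjoints_subset.
    by case: (_ \subset _); rewrite ?mulr1 ?mulr0.
  by rewrite -(cardsC (nbr w S)) exprD invfM mulfVK// expf_neq0.
(* [l] is the exponent carried by each element of [~: T]: [m * q * z] equals [l * #|~: T|]. *)
set l := m%:R * q / #|V|%:R.
have l0 : 0 <= l by rewrite divr_ge0 ?mulr_ge0 ?ler0n// ltW.
have l1 : 2 * l <= 1 by rewrite mulrA ler_pdivrMr// mul1r; lra.
have term (T : {set V}) : (1 - #|T|%:R / #|V|%:R) ^+ (#|S| * d) <=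
    (q ^+ m)^-1 * expR (- m%:R) * expR l ^+ #|~: T|.
  have -> : 1 - #|T|%:R / #|V|%:R = #|~: T|%:R / #|V|%:R :> R.
    by rewrite -{1}(divff nz) -mulrBl -(cardsC T) natrD addrAC subrr add0r.
  set z := #|~: T|%:R / #|V|%:R.
  have z0 : 0 <= z by rewrite divr_ge0 ?ler0n.
  have z1 : z <= 1 by rewrite ler_pdivrMr// mul1r ler_nat max_card.
  apply: le_trans (ler_wiXn2l z0 z1 msd) _.
  have -> : (q ^+ m)^-1 * expR (- m%:R) * expR l ^+ #|~: T| =
      (q^-1 * expR (q * z - 1)) ^+ m.
    rewrite exprMn exprVn -mulrA; congr (_ * _).
    rewrite -!expRM_natl -expRD; congr expR.
    by rewrite /l /z; field.
  apply: lerXn2r; rewrite ?nnegrE ?mulr_ge0 ?invr_ge0 ?expR_ge0 ?(ltW q0)//.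
  rewrite mulrC ler_pdivlMr//; apply: le_trans _ (expR_ge1Dx _); lra.
apply: (@le_trans _ _ ((q ^+ #|V|)^-1 *
   \sum_(T : {set V}) (q - 1) ^+ #|T| * ((q ^+ m)^-1 * expR (- m%:R) * expR l ^+ #|~: T|))).
  rewrite /avg (eq_bigr _ (fun w _ => expand w)) -/(avg _) avgZ avg_sum.
  rewrite ler_wpM2l ?invr_ge0 ?exprn_ge0 ?(ltW q0)//; apply: ler_sum => T _.
  rewrite avgZ ler_wpM2l ?exprn_ge0 ?subr_ge0//.
  by apply: le_trans (term T); apply: avg_disjoint_nbr.
have -> : \sum_(T : {set V})
      (q - 1) ^+ #|T| * ((q ^+ m)^-1 * expR (- m%:R) * expR l ^+ #|~: T|) =
    (q ^+ m)^-1 * expR (- m%:R) * (q - 1 + expR l) ^+ #|V|.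
  by rewrite -sum_sets_exp mulr_sumr; apply: eq_bigr => T _; rewrite mulrCA.
(* As [#|V| * l / q = m], the linear term in [l] cancels [expR (- m%:R)] and only the quadratic one
   survives. *)
have -> : 2 * q * m%:R ^+ 2 / #|V|%:R = - m%:R + #|V|%:R * ((l + 2 * l ^+ 2) / q).
  by rewrite /l; field; rewrite qz nz.
rewrite -mulrA mulrCA ler_wpM2l ?invr_ge0 ?exprn_ge0 ?(ltW q0)//.
rewrite mulrCA expRD ler_wpM2l ?expR_ge0// expRM_natl -exprVn -exprMn.
apply: lerXn2r; rewrite ?nnegrE ?mulr_ge0 ?invr_ge0 ?expR_ge0 ?(ltW q0)//.
  by rewrite addr_ge0 ?expR_ge0 ?subr_ge0.
apply: le_trans (expR_ge1Dx _).
rewrite mulrC ler_pdivrMr// mulrDl divfK// mul1r.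
have := expR_le_quadratic l0 l1; lra.
Qed.

(** When the indicator is 1, some [T] of size [#|S|] misses the neighbourhood, and the quotient of
    powers is at most 1 because [nbr w S] is at least as large as [S]. The bound is a union bound
    over all such [T]. *)
Lemma avg_large_nbr (R : realType) d (V : finType) (S : {set V}) (q : R) :
  (0 < #|V|)%N -> (0 < d)%N -> 1 <= q ->
  avg (fun w : {ffun 'I_d -> {perm V}} =>
         (#|S| <= #|V| - #|nbr w S|)%:R * (q ^+ #|S| / q ^+ #|nbr w S|))
    <= 'C(#|V|, #|S|)%:R * (1 - #|S|%:R / #|V|%:R) ^+ (#|S| * d).
Proof.
move=> V0 d0 q1; have q0 : 0 < q by lra.
apply: (@le_trans _ _ (avg (fun w : {ffun 'I_d -> {perm V}} =>
   \sum_(T : {set V} | #|T| == #|S|) [disjoint nbr w S & T]%:R))).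
  apply: ler_avg => w; case: leqP => [h|_]; last by rewrite mul0r sumr_ge0.
  rewrite mul1r; apply: (@le_trans _ _ 1).
    by rewrite ler_pdivrMr ?exprn_gt0// mul1r ler_weXn2l// leq_card_nbr.
  have : (0 < #|[set T : {set V} | T \subset ~: nbr w S & #|T| == #|S|]|)%N.
    by rewrite cards_draws bin_gt0 [#|~: _|]cardsCs setCK.
  case/card_gt0P => T; rewrite inE => /andP[TN TS].
  rewrite (bigD1 T)//= disjoint_sym disjoints_subset TN lerDl.
  by apply: sumr_ge0.
rewrite avg_sum -card_draws mulr_natl -sumr_const.
rewrite [leRHS](eq_bigl (fun T : {set V} => #|T| == #|S|)) => [|T]; last by rewrite inE.
apply: ler_sum => T /eqP TS; rewrite -[X in X%:R / _]TS; exact: avg_disjoint_nbr.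
Qed.

(** * The bipartite graph of a tuple of permutations *)

(** Exchanging the two sides of the graph amounts to inverting every permutation. *)
Definition invs d (V : finType) (w : {ffun 'I_d -> {perm V}}) : {ffun 'I_d -> {perm V}} :=
  [ffun i => (w i)^-1%g].

Lemma invsK d (V : finType) : involutive (@invs d V).
Proof. by move=> w; apply/ffunP => i; rewrite !ffunE invgK. Qed.

Definition perm_adj d (V : finType) (w : {ffun 'I_d -> {perm V}}) : rel (V + V) :=
  fun u v => match u, v with
  | inl a, inr b | inr b, inl a => [exists i, w i a == b]
  | _, _ => false
  end.

Lemma perm_adj_sym d (V : finType) (w : {ffun 'I_d -> {perm V}}) : symmetric (perm_adj w).
Proof. by move=> [a|b] [a'|b']. Qed.

Lemma perm_adj_irrefl d (V : finType) (w : {ffun 'I_d -> {perm V}}) :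
  irreflexive (perm_adj w).
Proof. by move=> [a|b]. Qed.

Definition perm_graph d (V : finType) (w : {ffun 'I_d -> {perm V}}) : sgraph :=
  SGraph (perm_adj_sym w) (perm_adj_irrefl w).

Definition left_side d (V : finType) (w : {ffun 'I_d -> {perm V}}) : {set perm_graph w} :=
  [set inl x | x in V].

Definition right_side d (V : finType) (w : {ffun 'I_d -> {perm V}}) : {set perm_graph w} :=
  [set inr x | x in V].

Lemma inl_injective (U V : Type) : injective (@inl U V).
Proof. by move=> x y []. Qed.

Lemma inr_injective (U V : Type) : injective (@inr U V).
Proof. by move=> x y []. Qed.

Lemma perm_graph_bipartition d (V : finType) (w : {ffun 'I_d -> {perm V}}) :
  bipartition (left_side w) (right_side w).
Proof.
split.
- apply/pred0P => v /=; apply/negP => /andP[/imsetP[x _ ->] /imsetP[y _]] //.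
- by apply/setP => -[x|x]; rewrite !inE imset_f ?orbT.
- by case=> [a|b] [a'|b'] //= _; rewrite !imset_f ?orbT.
Qed.

Lemma nbhd_inl d (V : finType) (w : {ffun 'I_d -> {perm V}}) (S : {set V}) :
  nbhd ([set inl x | x in S] : {set perm_graph w}) = [set inr x | x in nbr w S].
Proof.
apply/setP => -[a|b]; rewrite inE.
  apply/andP/imsetP => [[_ /exists_inP[[a'|b'] //]]|[? _ //]].
  by case/imsetP.
rewrite (mem_imset _ _ (@inr_injective V V)).
apply/andP/nbrP => [[_ /exists_inP[u /imsetP[a aS ->] /= /existsP[i /eqP <-]]]|].
  by exists i, a.
move=> [i [x xS ->]]; split; first by apply/imsetP => -[].
by apply/exists_inP; exists (inl x); [apply: imset_f | apply/existsP; exists i].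
Qed.

Lemma nbhd_inr d (V : finType) (w : {ffun 'I_d -> {perm V}}) (T : {set V}) :
  nbhd ([set inr x | x in T] : {set perm_graph w}) = [set inl x | x in nbr (invs w) T].
Proof.
apply/setP => -[a|b]; rewrite inE; last first.
  apply/andP/imsetP => [[_ /exists_inP[[a'|b'] //]]|[? _ //]].
  by case/imsetP.
rewrite (mem_imset _ _ (@inl_injective V V)).
apply/andP/nbrP => [[_ /exists_inP[u /imsetP[b bS ->] /= /existsP[i /eqP e]]]|].
  by exists i, b; rewrite // ffunE -e permK.
move=> [i [x xS ->]]; split; first by apply/imsetP => -[].
apply/exists_inP; exists (inr x); first exact: imset_f.
by apply/existsP; exists i; rewrite ffunE permKV.
Qed.

Lemma card_nbr1_le d (V : finType) (w : {ffun 'I_d -> {perm V}}) x :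
  (#|nbr w [set x]| <= d)%N.
Proof.
apply: (@leq_trans #|[set w i x | i in 'I_d]|); last first.
  by apply: leq_trans (leq_imset_card _ _) _; rewrite card_ord.
apply: subset_leq_card; apply/subsetP => y /nbrP[i [z /set1P -> ->]].
exact: imset_f.
Qed.

(** One permutation alone gives each vertex a neighbour; edges shared by several permutations merge,
    so [d] is only an upper bound. *)
Lemma perm_graph_degree d (V : finType) (w : {ffun 'I_d -> {perm V}}) (v : perm_graph w) :
  (0 < d)%N -> (1 <= #|nbhd [set v]| <= d)%N.
Proof.
move=> d0; case: v => x.
  rewrite -(imset_set1 inl) nbhd_inl card_imset; last exact: inr_injective.
  by rewrite card_nbr1_le andbT -(cards1 x) leq_card_nbr.
rewrite -(imset_set1 inr) nbhd_inr card_imset; last exact: inl_injective.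
by rewrite card_nbr1_le andbT -(cards1 x) leq_card_nbr.
Qed.

(** * From closed sets to expected weights of small sets *)

(** The boolean factor keeps [S] only when it is the smaller member of its pair. All such sets
    count, closed or not, so that expectations can be taken set by set. *)
Definition weight (R : realType) (q : R) d (V : finType) (w : {ffun 'I_d -> {perm V}})
    (S : {set V}) : R :=
  (#|S| <= #|V| - #|nbr w S|)%:R * (q ^+ #|S| / q ^+ #|nbr w S|).

Lemma ler_sum_inj (R : realType) (I J : finType) (A : {set I}) (P : pred J) (h : I -> J)
    (F : J -> R) :
  {in A &, injective h} -> (forall i, i \in A -> P (h i)) -> (forall j, 0 <= F j) ->
  \sum_(i in A) F (h i) <= \sum_(j | P j) F j.
Proof.
move=> hinj hP F0; rewrite -(big_imset _ hinj) big_mkcond [leRHS]big_mkcond /=.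
apply: ler_sum => j _; case: ifPn => [/imsetP[i /hP Pi ->]|_]; first by rewrite Pi.
by case: ifP.
Qed.

(** Closedness gives each vertex outside [S] a neighbour outside [nbr w S], while a vertex of [S]
    has none. So [S] is recovered from the complement of its neighbourhood. *)
Lemma nbr_invs_closed d (V : finType) (w : {ffun 'I_d -> {perm V}}) (S : {set V}) :
  (forall x, x \notin S -> ~~ (nbr w [set x] \subset nbr w S)) ->
  nbr (invs w) (~: nbr w S) = ~: S.
Proof.
move=> closedS; apply/setP => y; rewrite inE; apply/nbrP/idP => [[i [z + ->]]|yS].
  rewrite inE ffunE; apply: contra => wzS; apply/nbrP.
  by exists i, ((w i)^-1%g z); rewrite ?permKV.
have /subsetPn[z /nbrP[i [x /set1P -> zw] zS]] := closedS _ yS.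
by exists i, z; rewrite ?inE// zw ffunE permK.
Qed.

(* A closed set [S] and [T := ~: nbr w S] determine each other and have the same weight
   [q ^ (#|S| + #|T| - #|V|)]; each pair is charged to the smaller of its two members. *)
Lemma cG_perm_graph_le (R : realType) p d (V : finType) (w : {ffun 'I_d -> {perm V}}) :
  (0 < p)%N ->
  cG R p (left_side w) (right_side w) <=
    \sum_(S : {set V} | S != set0) weight p%:R w S +
    \sum_(S : {set V} | S != set0) weight p%:R (invs w) S.
Proof.
move=> p0; have q0 : 0 < p%:R :> R by rewrite ltr0n.
have qz : p%:R != 0 :> R by rewrite gt_eqF.
have wt0 w' (S : {set V}) : 0 <= weight (p%:R : R) (w' : {ffun 'I_d -> {perm V}}) S.
  by rewrite /weight mulr_ge0 ?ler0n// divr_ge0// exprn_ge0 ?ltW.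
pose L (S : {set perm_graph w}) : {set V} := [set x | inl x \in S].
pose D (S : {set perm_graph w}) : {set V} := ~: nbr w (L S).
have closedP S : S \in closedFamily (left_side w) (right_side w) ->
    [/\ S = [set inl x | x in L S], L S != set0, D S != set0 &
        nbr (invs w) (D S) = ~: L S].
  rewrite inE => /and4P[S0 SA NB clos].
  have SL : S = [set inl x | x in L S].
    apply/setP => u; apply/idP/imsetP => [uS|[x + ->]]; last by rewrite inE.
    have /imsetP[x _ ux] := subsetP (proper_sub SA) _ uS.
    by exists x; rewrite ?inE -?ux.
  split=> //.
  - by apply: contraNneq S0 => L0; rewrite SL L0 imset0.
  - apply: contraNneq NB => D0; rewrite SL nbhd_inl.
    have -> : nbr w (L S) = [set: V] by rewrite -[LHS]setCK -/(D S) D0 setC0.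
    by apply/eqP/setP => u; apply/imsetP/imsetP => -[x _ ->]; exists x.
  - apply: nbr_invs_closed => x xS.
    have := forall_inP clos (inl x); rewrite !inE imset_f// andbT.
    rewrite inE in xS => /(_ xS); apply: contra => sub.
    by rewrite -(imset_set1 inl) SL !nbhd_inl imsetS.
have -> : cG R p (left_side w) (right_side w) =
    \sum_(S in closedFamily (left_side w) (right_side w))
      p%:R ^+ #|L S| / p%:R ^+ #|nbr w (L S)|.
  apply: eq_bigr => S /closedP[SL _ _ _].
  rewrite {1 2}SL nbhd_inl !card_imset; [|exact: inr_injective|exact: inl_injective].
  by rewrite expfzDr// exprnN.
apply: (@le_trans _ _ (\sum_(S in closedFamily (left_side w) (right_side w))
   (weight p%:R w (L S) + weight p%:R (invs w) (D S)))).
  apply: ler_sum => S /closedP[_ _ _ nD].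
  have [small|large] := leqP #|L S| (#|V| - #|nbr w (L S)|).
    by rewrite {1}/weight small mul1r lerDl.
  have cD : #|D S| = (#|V| - #|nbr w (L S)|)%N by rewrite cardsCs setCK.
  have cL : #|~: L S| = (#|V| - #|L S|)%N by rewrite cardsCs setCK.
  have [LV NV] := (max_card (mem (L S)), max_card (mem (nbr w (L S)))).
  rewrite [weight _ (invs w) _]/weight nD cD cL subKn// (ltnW large) mul1r.
  rewrite -[leLHS]add0r lerD// ler_pdivrMr ?exprn_gt0// mulrAC ler_pdivlMr ?exprn_gt0//.
  by rewrite -!exprD subnKC// subnK.
rewrite big_split /=; apply: lerD.
  apply: ler_sum_inj => // [S S' /closedP[SL _ _ _] /closedP[SL' _ _ _] e|S /closedP[]//].
  by rewrite SL SL' e.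
apply: ler_sum_inj => // [S S' /closedP[SL _ _ nD] /closedP[SL' _ _ nD'] e|S /closedP[]//].
by rewrite SL SL' -[L S]setCK -nD e nD' setCK.
Qed.

(** Some tuple does no worse than the average of both sums in [cG_perm_graph_le]. As [invs] is a
    bijection on tuples, the two sums have the same average, whence the factor 2. *)
Lemma exists_perm_graph (R : realType) p d (V : finType) : (0 < p)%N ->
  exists w : {ffun 'I_d -> {perm V}},
    cG R p (left_side w) (right_side w) <=
      2 * \sum_(S : {set V} | S != set0)
            avg (fun w' : {ffun 'I_d -> {perm V}} => weight p%:R w' S).
Proof.
move=> p0.
pose X (w : {ffun 'I_d -> {perm V}}) := \sum_(S : {set V} | S != set0) weight (p%:R : R) w S.
have W0 : (0 < #|{ffun 'I_d -> {perm V}}|)%N by rewrite card_perms expn_gt0 fact_gt0.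
have [w hw] := exists_le_avg (fun w => X w + X (invs w)) W0.
exists w; apply: le_trans (cG_perm_graph_le R w p0) (le_trans hw _).
have sumX : \sum_w X (invs w) = \sum_w X w.
  by rewrite [RHS](reindex_inj (can_inj (@invsK d V))).
rewrite -avg_sum -/X /avg big_split /= sumX.
lra.
Qed.

(** * Estimates for the summation over set sizes *)

Lemma card_sets (V : finType) : #|{set V}| = (2 ^ #|V|)%N.
Proof. by rewrite -[#|V|]cardsT -card_powerset powersetT cardsT. Qed.

Lemma expR_half_le2 (R : realType) : expR (2^-1) <= 2 :> R.
Proof. by apply: le_trans (expR_le_quadratic _ _) _; lra. Qed.

Lemma sum_by_card (R : realType) (V : finType) (P : pred nat) (F : nat -> R) :
  \sum_(S : {set V} | P #|S|) F #|S| = \sum_(s < #|V|.+1 | P s) 'C(#|V|, s)%:R * F s.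
Proof.
have cV (S : {set V}) : (#|S| < #|V|.+1)%N by rewrite ltnS max_card.
rewrite (partition_big (fun S : {set V} => inord #|S| : 'I_#|V|.+1) (fun s => P s)) /=.
  apply: eq_bigr => s Ps; rewrite -card_draws mulr_natl -sumr_const.
  apply: eq_big => [S|S /andP[_ /eqP <-]]; last by rewrite inordK.
  rewrite inE -val_eqE /= inordK//; case: eqP => [->|]; rewrite ?andbF//.
  by rewrite Ps.
by move=> S; rewrite inordK.
Qed.

Lemma sum_geometric_le (R : realType) (r : R) n :
  0 <= r -> 2 * r <= 1 -> \sum_(i < n) r ^+ i.+1 <= 2 * r.
Proof.
(* The induction needs the stronger claim with the tail bound [2 * r ^+ n.+1] added. *)
move=> r0 r1; suff : \sum_(i < n) r ^+ i.+1 + 2 * r ^+ n.+1 <= 2 * r.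
  by have := exprn_ge0 n.+1 r0; lra.
elim: n => [|n IH]; first by rewrite big_ord0 add0r expr1.
rewrite big_ord_recr /= -addrA; apply: le_trans IH; rewrite lerD2l.
by have := exprn_ge0 n.+1 r0; rewrite [r ^+ n.+2]exprS; nra.
Qed.

(** Combines ['C(n, s) <= n ^ s / s!] with [s ^ s / s! <= expR s], the left side being one term of
    the exponential series. *)
Lemma bin_le_expR (R : realType) n s :
  (0 < s)%N -> 'C(n, s)%:R <= (expR 1 * n%:R / s%:R) ^+ s :> R.
Proof.
move=> s0; have sR : 0 < s%:R :> R by rewrite ltr0n.
have fR : 0 < (s`!)%:R :> R by rewrite ltr0n fact_gt0.
have ffact : 'C(n, s)%:R * (s`!)%:R <= n%:R ^+ s :> R.
  rewrite -natrM bin_ffact -natrX ler_nat ffact_prod.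
  rewrite -[X in (n ^ X)%N]card_ord -prod_nat_const.
  by apply: leq_prod => i _; rewrite leq_subr.
have efact : s%:R ^+ s <= expR 1 ^+ s * (s`!)%:R :> R.
  rewrite -ler_pdivrMr// -expRM_natl mulr1.
  by case: s s0 sR {fR ffact} => // s _ _; have := @expR_ge1Dxn R s.+1%:R s (ler0n _ _); lra.
rewrite expr_div_n exprMn ler_pdivlMr ?exprn_gt0//.
apply: le_trans (ler_wpM2l (ler0n _ _) efact) _.
by rewrite mulrCA ler_wpM2l ?exprn_ge0 ?expR_ge0.
Qed.

(** Let [b] be the exponent. If [b <= 1] the claim is clear. Otherwise
    [s > n / (2 * q * d ^+ 2) >= expR (d / 8)], whereas [16 * q * s * d <= n] gives [b <= d / 8]. *)
Lemma expR_le_linear (R : realType) (n q d s : R) :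
  0 < n -> 0 < q -> 0 < d -> 1 <= s -> 16 * q * s * d <= n ->
  expR (d / 4) <= n -> 2 * q * d ^+ 2 <= expR (d / 8) ->
  expR (2 * q * d ^+ 2 / n * s) <= expR 1 * s.
Proof.
move=> n0 q0 d0 s1 sn dn qd; set b := _ / n * s.
have e1 : 1 <= expR (1 : R) by rewrite -expR0 ler_expR.
have [b1|b1] := lerP b 1.
  by apply: (@le_trans _ _ (expR 1)); rewrite ?ler_expR// ler_peMr// expR_ge0.
have bd : b <= d / 8.
  by rewrite /b mulrAC ler_pdivrMr//; nra.
apply: (@le_trans _ _ (expR (d / 8))); first by rewrite ler_expR.
have d8 : expR (d / 4) = expR (d / 8) * expR (d / 8).
  by rewrite -expRD; congr expR; lra.
have ns : n < 2 * q * d ^+ 2 * s by move: b1; rewrite /b mulrAC ltr_pdivlMr// mul1r.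
have ep := expR_gt0 (d / 8).
have : expR (d / 8) <= s by rewrite -(ler_pM2l ep); nra.
nra.
Qed.

(** The exponential costs at most [(expR 1 * s) ^+ s], and its [s ^+ s] cancels the denominator in
    [bin_le_expR]. *)
Lemma small_term_le (R : realType) (q : R) n d s :
  1 <= q -> (0 < n)%N -> (0 < d)%N -> (0 < s)%N -> 16 * q * s%:R * d%:R <= n%:R ->
  expR (d%:R / 4) <= n%:R :> R -> 2 * q * d%:R ^+ 2 <= expR (d%:R / 8) ->
  'C(n, s)%:R * (q ^+ s * ((q ^+ (s * d))^-1 * expR (2 * q * (s * d)%:R ^+ 2 / n%:R)))
    <= (expR 2 * q * n%:R / q ^+ d) ^+ s.
Proof.
move=> q1 n0 d0 s0 sn dn qd; have q0 : 0 < q by lra.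
have [nR dR sR] : [/\ 0 < n%:R :> R, 0 < d%:R :> R & 1 <= s%:R :> R].
  by rewrite !ltr0n ler1n.
have qdp : 0 < q ^+ d by rewrite exprn_gt0.
have lin := expR_le_linear nR q0 dR sR sn dn qd.
apply: le_trans (ler_wpM2r _ (bin_le_expR R n s0)) _.
  by rewrite !mulr_ge0 ?invr_ge0 ?exprn_ge0 ?expR_ge0// ltW.
have -> : 2 * q * (s * d)%:R ^+ 2 / n%:R = s%:R * (2 * q * d%:R ^+ 2 / n%:R * s%:R) :> R.
  by rewrite natrM; ring.
rewrite expRM_natl mulnC exprM -exprVn -!exprMn.
have sz : s%:R != 0 :> R by rewrite gt_eqF//; lra.
apply: lerXn2r; rewrite ?nnegrE ?mulr_ge0 ?invr_ge0 ?expR_ge0 ?(ltW nR) ?(ltW qdp)//; try lra.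
have -> : expR 2 * q * n%:R / q ^+ d =
    expR 1 * n%:R / s%:R * (q * ((q ^+ d)^-1 * (expR 1 * s%:R))).
  have -> : (2 : R) = 1 + 1 by lra.
  by rewrite expRD; field; rewrite sz gt_eqF.
rewrite !ler_wpM2l ?mulr_ge0 ?invr_ge0 ?expR_ge0 ?(ltW nR) ?(ltW qdp)//; lra.
Qed.

(** * Expected weights in the three size ranges, and their sum *)

Lemma avg_weight_le (R : realType) (q : R) d (V : finType) (S : {set V}) m :
  (0 < #|V|)%N -> 1 <= q -> (m <= #|S| * d)%N -> 2 * q * m%:R <= #|V|%:R ->
  avg (fun w : {ffun 'I_d -> {perm V}} => weight q w S)
    <= q ^+ #|S| * ((q ^+ m)^-1 * expR (2 * q * m%:R ^+ 2 / #|V|%:R)).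
Proof.
move=> V0 q1 msd qm; have q0 : 0 < q by lra.
apply: le_trans (ler_wpM2l _ (avg_inv_nbr V0 q1 msd qm)); last by rewrite exprn_ge0 ?ltW.
rewrite -avgZ; apply: ler_avg => w; rewrite /weight; case: (_ <= _)%N; rewrite ?mul1r//.
by rewrite mul0r divr_ge0// exprn_ge0 ?ltW.
Qed.

(** For [m] between [#|V| / (32 p)] and [#|V| / (16 p)], the power [p ^ - m] is at most
    [expR (- m / 2)] and the correction at most [expR (m / 8)]; the resulting [3 m / 8] exceeds
    [#|V| / (128 p)]. *)
Lemma medium_avg_weight_le (R : realType) p d (V : finType) (S : {set V}) :
  (1 < p)%N -> (0 < d)%N -> (32 * p * d <= #|V|)%N -> (#|V| %/ (16 * p * d) <= #|S|)%N ->
  avg (fun w : {ffun 'I_d -> {perm V}} => weight p%:R w S)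
    <= p%:R ^+ #|S| * expR (- (#|V|%:R / (128 * p%:R))) :> R.
Proof.
move=> p1 d0 dV sS; set s0 := (_ %/ _)%N in sS.
have V0 : (0 < #|V|)%N by apply: leq_trans dV; rewrite !muln_gt0 d0 (ltnW p1).
have [q2 dR] : 2 <= p%:R :> R /\ 0 < d%:R :> R by rewrite ler_nat ltr0n.
have q0 : 0 < p%:R :> R by lra.
(* The moment is taken at the threshold size [s0] instead of [#|S|], which keeps [2 * p * m <= #|V|]
   for every larger [S]. *)
pose m := (s0 * d)%N.
have mV : (16 * p * m <= #|V|)%N.
  by rewrite /m mulnA [(16 * p * s0)%N]mulnC -mulnA leq_trunc_div.
have Vm : (#|V| <= 16 * p * m + 16 * p * d)%N.
  have := @ltn_ceil #|V| (16 * p * d) ltac:(by rewrite !muln_gt0 d0 (ltnW p1)).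
  by rewrite -/s0 /m => /ltnW; rewrite mulSn addnC; congr leq; ring.
have msd : (m <= #|S| * d)%N by rewrite leq_mul2r sS orbT.
clearbody m.
move: mV Vm dV; rewrite -!(ler_nat R) natrD !natrM => mV Vm dV.
have nR : 0 < #|V|%:R :> R by rewrite ltr0n.
have mR : 0 <= m%:R :> R by rewrite ler0n.
have pm : 0 <= p%:R * m%:R :> R by rewrite mulr_ge0// ltW.
have q1 : 1 <= p%:R :> R by lra.
have qm : 2 * p%:R * m%:R <= #|V|%:R :> R by rewrite -mulrA; rewrite -mulrA in mV; lra.
apply: le_trans (avg_weight_le V0 q1 msd qm) _.
rewrite ler_wpM2l ?exprn_ge0 ?(ltW q0)//.
apply: (@le_trans _ _ (expR (- (m%:R / 2)) * expR (m%:R / 8))).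
  apply: ler_pM; rewrite ?invr_ge0 ?exprn_ge0 ?expR_ge0 ?(ltW q0)//.
    rewrite expRN lef_pV2 ?posrE ?expR_gt0 ?exprn_gt0// expRM_natl.
    apply: lerXn2r; rewrite ?nnegrE ?expR_ge0 ?(ltW q0)//.
    exact: le_trans (expR_half_le2 R) q2.
  by rewrite ler_expR ler_pdivrMr//; nra.
rewrite -expRD ler_expR.
have -> : - (m%:R / 2) + m%:R / 8 = - (3 / 8 * m%:R) :> R by lra.
by rewrite lerN2 ler_pdivrMr; [nra | lra].
Qed.

(** The power in [avg_large_nbr] is at most [expR (- s ^ 2 * d / n) <= expR (- 3 n)]. One factor
    [2 ^ n] pays for the binomial coefficient, and a second is set aside for the later sum over all
    sets [S]. *)
Lemma large_avg_weight_le (R : realType) (q e : R) d (V : finType) (S : {set V}) :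
  (0 < #|V|)%N -> 1 <= q -> (0 < d)%N -> 0 <= e -> e * #|V|%:R <= #|S|%:R ->
  3 <= e ^+ 2 * d%:R ->
  avg (fun w : {ffun 'I_d -> {perm V}} => weight q w S)
    <= (2 ^+ #|V|)^-1 * expR (- #|V|%:R) :> R.
Proof.
move=> V0 q1 d0 e0 eS ed; have nR : 0 < #|V|%:R :> R by rewrite ltr0n.
apply: le_trans (avg_large_nbr S V0 d0 q1) _.
set s := #|S| in eS *; set n := #|V| in V0 nR eS *.
have bin2 : 'C(n, s)%:R <= 2 ^+ n :> R.
  rewrite -natrX ler_nat -card_draws.
  by apply: leq_trans (max_card _) _; rewrite card_sets.
have sn : s%:R <= n%:R :> R by rewrite ler_nat max_card.
have e2 : 2 <= expR (1 : R) by apply: le_trans (expR_ge1Dx _); lra.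
have pow2 : 2 ^+ n <= expR n%:R :> R.
  by rewrite -[n%:R]mulr1 expRM_natl; apply: lerXn2r; rewrite ?nnegrE ?expR_ge0//.
have pw : (1 - s%:R / n%:R) ^+ (s * d) <= expR (- (3 * n%:R)) :> R.
  apply: (@le_trans _ _ (expR (- (s%:R / n%:R)) ^+ (s * d))).
    apply: lerXn2r; rewrite ?nnegrE ?expR_ge0//; last exact: expR_ge1Dx.
    by rewrite subr_ge0 ler_pdivrMr// mul1r.
  rewrite -expRM_natl ler_expR mulrN lerN2 natrM mulrA ler_pdivlMr//.
  have sq : e ^+ 2 * n%:R ^+ 2 <= s%:R * s%:R.
    have : 0 <= e * n%:R by rewrite mulr_ge0// ltW.
    nra.
  have dR : 0 <= d%:R :> R by rewrite ler0n.
  have := ler_wpM2r dR sq; have := ler_wpM2r (sqr_ge0 (n%:R : R)) ed; nra.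
apply: (@le_trans _ _ (2 ^+ n * expR (- (3 * n%:R)))).
  by apply: ler_pM => //; rewrite ?exprn_ge0// subr_ge0 ler_pdivrMr// mul1r.
rewrite ler_pdivlMl ?exprn_gt0//.
have -> : - n%:R = n%:R + (n%:R + - (3 * n%:R)) :> R by lra.
rewrite 2!expRD; apply: ler_pM; rewrite ?mulr_ge0 ?exprn_ge0 ?expR_ge0//.
by rewrite ler_wpM2r ?expR_ge0.
Qed.

(** [y] makes the medium bound [p ^ #|S| * expR (- 4 y n)], with [n] for [#|V|], and [e] ensures
    [(p / y) ^ #|S| <= expR (y n)] when [#|S| < e n]. Such a set then costs at most
    [y ^ #|S| * expR (- 3 y n)], and summing [y ^ #|S|] over all sets gives
    [(1 + y) ^ n <= expR (y n)]. *)
Lemma sum_avg_weight_le (R : realType) p d (V : finType)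
    (y := (512 * p%:R)^-1 : R) (e := y / ln (p%:R / y))
    (r := expR 2 * p%:R * #|V|%:R / p%:R ^+ d) :
  (1 < p)%N -> (0 < d)%N -> (32 * p * d <= #|V|)%N -> expR (d%:R / 4) <= #|V|%:R :> R ->
  2 * p%:R * d%:R ^+ 2 <= expR (d%:R / 8) :> R -> 2 * r <= 1 -> 3 <= e ^+ 2 * d%:R ->
  \sum_(S : {set V} | S != set0)
      avg (fun w : {ffun 'I_d -> {perm V}} => weight p%:R w S)
    <= 2 * r + expR (- (2 * y * #|V|%:R)) + expR (- #|V|%:R).
Proof.
move=> p1 d0 dV dn qd r1 ed.
have V0 : (0 < #|V|)%N by apply: leq_trans dV; rewrite !muln_gt0 d0 (ltnW p1).
have q2 : 2 <= p%:R :> R by rewrite ler_nat.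
have [q0 q1] : 0 < p%:R :> R /\ 1 <= p%:R :> R by split; lra.
have y0 : 0 < y by rewrite invr_gt0; lra.
have y1 : y < 1 by rewrite invf_lt1; lra.
have qy1 : 1 < p%:R / y by rewrite ltr_pdivlMr//; lra.
have l0 : 0 < ln (p%:R / y) by rewrite ln_gt0.
have e0 : 0 <= e by rewrite divr_ge0// ltW.
have nR : 0 < #|V|%:R :> R by rewrite ltr0n.
have r0 : 0 <= r by rewrite divr_ge0 ?mulr_ge0 ?exprn_ge0 ?expR_ge0// ltW.
set s0 := (#|V| %/ (16 * p * d))%N.
pose F s : R := p%:R ^+ s *
  ((p%:R ^+ (s * d))^-1 * expR (2 * p%:R * (s * d)%:R ^+ 2 / #|V|%:R)).
have F0 s : 0 <= F s by rewrite !mulr_ge0 ?invr_ge0 ?exprn_ge0 ?expR_ge0// ltW.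
have s0V s : (s <= s0)%N -> 16 * p%:R * s%:R * d%:R <= #|V|%:R :> R.
  move=> ss; rewrite -!natrM ler_nat; apply: leq_trans (leq_trunc_div _ (16 * p * d)).
  by rewrite -/s0 mulnAC mulnC leq_mul.
have term (S : {set V}) : S != set0 ->
    avg (fun w : {ffun 'I_d -> {perm V}} => weight p%:R w S) <=
    (0 < #|S| <= s0)%N%:R * F #|S| + y ^+ #|S| * expR (- (3 * y * #|V|%:R))
      + (2 ^+ #|V|)^-1 * expR (- #|V|%:R).
  move=> S0; have yp s : 0 <= y ^+ s by rewrite exprn_ge0// ltW.
  have h2 : 0 <= y ^+ #|S| * expR (- (3 * y * #|V|%:R)) by rewrite mulr_ge0 ?expR_ge0.
  have h3 : 0 <= (2 ^+ #|V|)^-1 * expR (- #|V|%:R) :> R.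
    by rewrite mulr_ge0 ?expR_ge0 ?invr_ge0 ?exprn_ge0.
  rewrite card_gt0 S0 /=; have [small|medium] := leqP #|S| s0.
    rewrite mul1r -addrA; apply: ler_wpDr; first by rewrite addr_ge0.
    apply: avg_weight_le => //; have := s0V _ small.
    have : 0 <= p%:R * (#|S|%:R * d%:R) :> R by rewrite !mulr_ge0 ?ler0n.
    by rewrite natrM -!mulrA; lra.
  rewrite mul0r add0r.
  have [large|Se] := lerP (e * #|V|%:R) #|S|%:R.
    by apply: ler_wpDl => //; apply: (large_avg_weight_le _ _ d0 e0 large).
  apply: ler_wpDr => //; apply: le_trans (medium_avg_weight_le R p1 d0 dV (ltnW medium)) _.
  have -> : p%:R ^+ #|S| = y ^+ #|S| * expR (#|S|%:R * ln (p%:R / y)) :> R.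
    by rewrite expRM_natl lnK ?posrE ?divr_gt0// -exprMn mulrCA divff ?mulr1// gt_eqF.
  rewrite -mulrA ler_wpM2l// -expRD ler_expR.
  have -> : #|V|%:R / (128 * p%:R) = 4 * y * #|V|%:R :> R.
    by rewrite /y; field; rewrite gt_eqF.
  have : #|S|%:R * ln (p%:R / y) <= y * #|V|%:R.
    apply: le_trans (ler_wpM2r (ltW l0) (ltW Se)) _.
    by rewrite /e mulrAC divfK// gt_eqF.
  lra.
apply: le_trans (ler_sum _ term) _; rewrite !big_split /=; apply: lerD; first apply: lerD.
- apply: (@le_trans _ _ (\sum_(s < #|V|.+1 | (0 < s <= s0)%N) r ^+ s)).
    apply: (@le_trans _ _ (\sum_(S : {set V} | (0 < #|S| <= s0)%N) F #|S|)).
      rewrite big_mkcond [leRHS]big_mkcond; apply: ler_sum => S _.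
      by rewrite card_gt0; case: (S != set0); case: (_ <= _)%N; rewrite ?mul1r ?mul0r.
    rewrite (sum_by_card V (fun s => (0 < s <= s0)%N)); apply: ler_sum => s /andP[sp ss].
    by apply: small_term_le => //; apply: s0V.
  apply: le_trans _ (sum_geometric_le #|V| r0 r1).
  rewrite big_mkcond big_ord_recl /= add0r; apply: ler_sum => s _.
  by case: ifP => // _; rewrite exprn_ge0.
- apply: (@le_trans _ _ (\sum_(S : {set V}) y ^+ #|S| * expR (- (3 * y * #|V|%:R)))).
    rewrite big_mkcond; apply: ler_sum => S _.
    by case: ifP => // _; rewrite mulr_ge0 ?expR_ge0 ?exprn_ge0 ?ltW.
  rewrite -mulr_suml.
  have -> : \sum_(S : {set V}) y ^+ #|S| = (y + 1) ^+ #|V|.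
    by rewrite -sum_sets_exp; apply: eq_bigr => S _; rewrite expr1n mulr1.
  have -> : - (2 * y * #|V|%:R) = #|V|%:R * y + - (3 * y * #|V|%:R) by lra.
  rewrite expRD expRM_natl ler_wpM2r ?expR_ge0//.
  apply: lerXn2r; rewrite ?nnegrE ?expR_ge0 ?addr_ge0// ?(ltW y0)//.
  by rewrite addrC expR_ge1Dx.
- apply: (@le_trans _ _ (\sum_(S : {set V}) (2 ^+ #|V|)^-1 * expR (- #|V|%:R) : R)).
    rewrite big_mkcond; apply: ler_sum => S _.
    by case: ifP => // _; rewrite mulr_ge0 ?expR_ge0 ?invr_ge0 ?exprn_ge0.
  rewrite sumr_const card_sets -[leLHS]mulr_natl natrX.
  by rewrite mulVKf// expf_neq0// pnatr_eq0.
Qed.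

Lemma exists_sparse_graph (R : realType) p : (1 < p)%N ->
  exists (a : R) (D : nat), 0 < a /\ forall n d, (D <= d)%N -> (p ^ d <= n ^ 2)%N ->
    forall r : R, r = expR 2 * p%:R * n%:R / p%:R ^+ d -> 2 * r <= 1 ->
    exists w : {ffun 'I_d -> {perm 'I_n}},
      cG R p (left_side w) (right_side w) <=
        2 * (2 * r + expR (- (a * n%:R)) + expR (- n%:R)).
Proof.
move=> p1; pose y : R := (512 * p%:R)^-1; pose e := y / ln (p%:R / y).
have q2 : 2 <= p%:R :> R by rewrite ler_nat.
have q0 : 0 < p%:R :> R by lra.
have y0 : 0 < y by rewrite invr_gt0; lra.
have y1 : y < 1 by rewrite invf_lt1; lra.
have e0 : 0 < e by rewrite divr_gt0// ln_gt0// ltr_pdivlMr//; lra.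
(* [6144 * p <= d] yields [2 * p * d ^ 2 <= d ^ 3 / 3072], the cubic term of [expR (d / 8)]; the
   other bound yields [3 <= e ^+ 2 * d]. *)
exists (2 * y), (maxn (6144 * p) (Num.truncn (3 / e ^+ 2)).+1).
split=> [|n d]; first by rewrite mulr_gt0.
rewrite geq_max => /andP[pd ed] dn r rE r1.
have [w hw] := @exists_perm_graph R p d 'I_n (ltnW p1).
exists w; apply: le_trans hw _; rewrite ler_pM2l//.
have pdR : 6144 * p%:R <= d%:R :> R by rewrite -natrM ler_nat.
have d0 : (0 < d)%N by apply: leq_trans pd; rewrite muln_gt0 (ltnW p1).
have dR : 0 < d%:R :> R by rewrite ltr0n.
(* Squared, this follows from [expR (d / 2) <= 2 ^ d <= p ^ d <= n ^ 2]. *)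
have edn : expR (d%:R / 4) <= n%:R :> R.
  rewrite -(@ler_pXn2r _ 2)// ?nnegrE ?expR_ge0 ?ler0n// -expRM_natl.
  have -> : 2%:R * (d%:R / 4) = d%:R * 2^-1 :> R by lra.
  rewrite expRM_natl; apply: (@le_trans _ _ ((p ^ d)%:R)).
    rewrite natrX; apply: lerXn2r; rewrite ?nnegrE ?expR_ge0 ?ler0n//.
    exact: le_trans (expR_half_le2 R) q2.
  by rewrite -natrX ler_nat.
have qd : 2 * p%:R * d%:R ^+ 2 <= expR (d%:R / 8) :> R.
  have d8 : 0 <= d%:R / 8 :> R by lra.
  apply: le_trans (expR_ge1Dxn 2 d8); rewrite !factS fact0.
  have : 0 <= d%:R ^+ 2 * (d%:R - 6144 * p%:R) :> R by rewrite mulr_ge0 ?sqr_ge0 ?subr_ge0.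
  have -> : (d%:R / 8) ^+ 3 / (3 * (2 * (1 * 1)))%:R = d%:R ^+ 3 / 3072 :> R.
    by field.
  nra.
have dV : (32 * p * d <= n)%N.
  rewrite -(ler_nat R) !natrM; apply: le_trans edn.
  apply: (@le_trans _ _ (expR (d%:R / 8))); last by rewrite ler_expR; lra.
  apply: le_trans qd; nra.
have := @sum_avg_weight_le R p d 'I_n; rewrite card_ord -rE; apply=> //.
have /ltW : 3 / e ^+ 2 < d%:R.
  by apply: lt_le_trans (truncnS_gt _) _; rewrite ler_nat.
by rewrite ler_pdivrMr ?exprn_gt0// mulrC.
Qed.

(** * Asymptotics of the degree *)

Local Open Scope classical_set_scope.

Lemma near_le_lnln (R : realType) (A : R) : \forall n \near \oo, A <= ln (ln n%:R).
Proof.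
near=> n; have nA : expR (expR A) <= n%:R by near: n; exact: nbhs_infty_ger.
have n0 : 0 < n%:R :> R := lt_le_trans (expR_gt0 _) nA.
have lnA : expR A <= ln n%:R by rewrite -ler_expR lnK.
by rewrite -ler_expR lnK// posrE (lt_le_trans (expR_gt0 _) lnA).
Unshelve. all: by end_near. Qed.

(** The maximum with 1 keeps the degree positive for small [n], where [degBound] may drop below
    1. *)
Definition degree (R : realType) p (t : nat -> nat) n : nat :=
  maxn 1 (minn (t n) (Num.truncn (degBound R p n))).

(** Both members of the minimum exceed [logb p n] by an amount tending to infinity. *)
Lemma near_degree_ge (R : realType) p (t : nat -> nat) :
  (fun n : nat => (t n)%:R - logb p n%:R : R) @ \oo --> +oo ->
  forall A : R, \forall n \near \oo, A + logb p n%:R <= (degree R p t n)%:R.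
Proof.
move=> /cvgryPge t_lim A; near=> n.
have tn : A <= (t n)%:R - logb p n%:R by near: n; exact: t_lim.
(* The extra 1 pays for the truncation. *)
have ln2 : A + 1 <= ln (ln n%:R) by near: n; exact: near_le_lnln.
have := truncnS_gt (degBound R p n); rewrite -natr1 {1}/degBound => bn.
apply: (@le_trans _ _ ((minn (t n) (Num.truncn (degBound R p n)))%:R)); last first.
  by rewrite ler_nat leq_maxr.
by rewrite /minn; case: ifP => _; lra.
Unshelve. all: by end_near. Qed.

(** After taking logarithms, [ln p * ln (ln n) <= ln n] is what remains to be shown. *)
Lemma near_degree_le (R : realType) p (t : nat -> nat) : (1 < p)%N ->
  \forall n \near \oo, (p ^ degree R p t n <= n ^ 2)%N.
Proof.
move=> p1; have q1 : 1 < p%:R :> R by rewrite ltr1n.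
have l0 : 0 < ln p%:R :> R by rewrite ln_gt0.
near=> n.
have n1 : (1 <= n)%N by near: n; exact: nbhs_infty_ge.
(* The bound 1 puts [degBound] above the maximum with 1 in [degree]; the bound [2 * ln p] gives
   [ln p * ln (ln n) <= ln (ln n) ^ 2 / 2], which [quad] bounds by [ln n]. *)
have big : Num.max 1 (2 * ln p%:R) <= ln (ln n%:R) :> R by near: n; exact: near_le_lnln.
move: big; rewrite ge_max => /andP[big1 bigp].
have nR : 0 < n%:R :> R by rewrite ltr0n.
have lnn0 : 0 <= ln n%:R :> R by rewrite ln_ge0// ler1n.
have logb0 : 0 <= logb p n%:R :> R by rewrite /logb divr_ge0// ltW.
have b1 : 1 <= degBound R p n by rewrite /degBound; lra.
have db : (degree R p t n)%:R <= degBound R p n.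
  have : (Num.truncn (degBound R p n))%:R <= degBound R p n by rewrite truncn_le; lra.
  apply: le_trans; rewrite ler_nat geq_max truncn_gt0 b1 /=; exact: geq_minr.
have L0 : 0 < ln n%:R :> R.
  (* By convention [ln 0 = 0], so [ln n = 0] would contradict [big1]. *)
  rewrite lt_neqAle lnn0 andbT; apply: contraTneq big1 => <-.
  by rewrite ln0// -ltNge.
have quad : ln (ln n%:R) ^+ 2 <= 2 * ln n%:R :> R.
  have l2 : 0 <= ln (ln n%:R) :> R by lra.
  by have := expR_ge1Dxn 1 l2; rewrite lnK// !factS fact0; lra.
rewrite -(ler_nat R) !natrX -ler_ln ?posrE ?exprn_gt0//; last by lra.
rewrite !lnXn//; last by lra.
rewrite -(mulr_natl _ (degree R p t n)) -(mulr_natl _ 2).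
apply: le_trans (ler_wpM2r (ltW l0) db) _.
rewrite /degBound /logb mulrDl divfK ?gt_eqF//; nra.
Unshelve. all: by end_near. Qed.

(** Exponentiates [near_degree_ge] at [A = log_p K]; it forces the geometric ratio to tend to
    zero. *)
Lemma near_degree_expn_ge (R : realType) p (t : nat -> nat) : (1 < p)%N ->
  (fun n : nat => (t n)%:R - logb p n%:R : R) @ \oo --> +oo ->
  forall K : R, 0 < K -> \forall n \near \oo, K * n%:R <= p%:R ^+ degree R p t n.
Proof.
move=> p1 t_lim K K0; have q1 : 1 < p%:R :> R by rewrite ltr1n.
have q0 : 0 < p%:R :> R by lra.
have l0 : 0 < ln p%:R :> R by rewrite ln_gt0.
near=> n.
have n0 : 0 < n%:R :> R by rewrite ltr0n; near: n; exact: nbhs_infty_gt.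
have : ln K / ln p%:R + logb p n%:R <= (degree R p t n)%:R.
  by near: n; exact: near_degree_ge.
rewrite /logb -mulrDl ler_pdivrMr// mulr_natl -lnXn//.
by rewrite -lnM ?posrE// ler_ln ?posrE ?mulr_gt0 ?exprn_gt0.
Unshelve. all: by end_near. Qed.

Lemma near_expRN_le (R : realType) (b eps : R) : 0 < b -> 0 < eps ->
  \forall n \near \oo, expR (- (b * n%:R)) <= eps.
Proof.
move=> b0 eps0; near=> n.
rewrite -[leRHS]lnK ?posrE// ler_expR lerNl -ler_pdivrMl//.
by near: n; exact: nbhs_infty_ger.
Unshelve. all: by end_near. Qed.

(** * Choice of the graphs and passage to the limit *)

Theorem theorem5p1 (R : realType) (p : nat) (p_prime : prime p)
    (t : nat -> nat)
    (t_bounds : forall n : nat, (1 <= n)%N -> (1 <= t n <= n)%N)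
    (t_lim : (fun n : nat => (t n)%:R - logb p n%:R : R) @ \oo --> +oo) :
  exists (G : nat -> sgraph) (A B : forall n : nat, {set G n}),
    [/\ forall n : nat, (1 <= n)%N ->
          [/\ bipartition (A n) (B n),
              #|A n| = n, #|B n| = n &
              forall v : G n, v \in A n :|: B n ->
                (1 <= #|nbhd [set v]%SET| <= t n)%N /\
                (1 <= degBound R p n ->
                   #|nbhd [set v]%SET|%:R <= Num.min (t n)%:R (degBound R p n))]
      & (fun n : nat => cG R p (A n) (B n)) @ \oo --> (0 : R)].
Proof.
have p1 := prime_gt1 p_prime.
have q1 : 1 < p%:R :> R by rewrite ltr1n.
have q0 : 0 < p%:R :> R by lra.
have lq : 0 < ln p%:R :> R by rewrite ln_gt0.
have [a [D [a0 sparse]]] := exists_sparse_graph R p1.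
pose d := degree R p t.
pose r n : R := expR 2 * p%:R * n%:R / p%:R ^+ d n.
have d0 n : (0 < d n)%N by rewrite leq_max.
(* The bound is conditional so that a tuple can be chosen for every [n]; identity permutations serve
   when a condition fails, which happens only for finitely many [n]. *)
have good n : exists w : {ffun 'I_(d n) -> {perm 'I_n}},
    (D <= d n)%N -> (p ^ d n <= n ^ 2)%N -> 2 * r n <= 1 ->
    cG R p (left_side w) (right_side w) <=
      2 * (2 * r n + expR (- (a * n%:R)) + expR (- n%:R)).
  have [dD|] := boolP (D <= d n)%N; last by exists [ffun=> 1%g].
  have [dn|] := boolP (p ^ d n <= n ^ 2)%N; last by exists [ffun=> 1%g].
  have [rn|] := boolP (2 * r n <= 1); last by exists [ffun=> 1%g].
  by have [w hw] := sparse n (d n) dD dn (r n) erefl rn; exists w.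
pose w n := sval (cid (good n)).
exists (fun n => perm_graph (w n)), (fun n => left_side (w n)), (fun n => right_side (w n)).
split=> [n n1|].
  split; first exact: perm_graph_bipartition.
  - by rewrite card_imset ?card_ord//; apply: inl_injective.
  - by rewrite card_imset ?card_ord//; apply: inr_injective.
  move=> v _; have /andP[v1 vd] := perm_graph_degree v (d0 n).
  have /andP[t1 _] := t_bounds n n1.
  have dt : (d n <= t n)%N by rewrite geq_max t1 geq_minl.
  split=> [|b1]; first by rewrite v1 (leq_trans vd dt).
  rewrite le_min ler_nat (leq_trans vd dt) /=.
  have : (Num.truncn (degBound R p n))%:R <= degBound R p n by rewrite truncn_le; lra.
  apply: le_trans; rewrite ler_nat; apply: leq_trans vd _.
  by rewrite geq_max truncn_gt0 b1 geq_minr.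
apply/cvgrPdist_le => eps eps0.
(* [1 / 2] secures [2 * r n <= 1]; with three quantities bounded by [eps / 8], the total is
   [2 * (2 + 1 + 1) * eps / 8 = eps]. *)
have Kr : 0 < Num.min (1 / 2) (eps / 8) by rewrite lt_min; lra.
have e8 : 0 < eps / 8 by lra.
have eK : 0 < expR 2 * p%:R / Num.min (1 / 2) (eps / 8).
  by rewrite !mulr_gt0 ?expR_gt0 ?invr_gt0.
near=> n.
have rK : r n <= Num.min (1 / 2) (eps / 8).
  have : expR 2 * p%:R / Num.min (1 / 2) (eps / 8) * n%:R <= p%:R ^+ d n.
    by near: n; exact: near_degree_expn_ge.
  by rewrite /r ler_pdivrMr ?exprn_gt0// mulrAC ler_pdivrMr// [_ ^+ _ * _]mulrC.
move: rK; rewrite le_min => /andP[r1 r2].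
have e1 : expR (- (a * n%:R)) <= eps / 8 by near: n; exact: near_expRN_le.
have e2 : expR (- (1 * n%:R)) <= eps / 8 by near: n; exact: near_expRN_le.
have dD : (D <= d n)%N.
  have n1 : (1 <= n)%N by near: n; exact: nbhs_infty_ge.
  rewrite -(ler_nat R); apply: (@le_trans _ _ (D%:R + logb p n%:R)).
    by rewrite lerDl /logb divr_ge0 ?(ltW lq)// ln_ge0 ?ler1n.
  by near: n; exact: near_degree_ge.
have dn : (p ^ d n <= n ^ 2)%N by near: n; exact: near_degree_le.
rewrite sub0r normrN ger0_norm; last by apply: sumr_ge0 => S _; apply: exprz_ge0; exact: ltW.
apply: le_trans (svalP (cid (good n)) dD dn _) _; first by lra.
by rewrite mul1r in e2; lra.
Unshelve. all: by end_near. Qed.
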